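(* The logic ${\sf ITL}^0_{\Diamond\forall}$ is complete for the class of dynamical systems: every $\mathcal L_{\Diamond\forall}$-formula valid on all dynamical systems belongs to ${\sf ITL}^0_{\Diamond\forall}$.
   Context: Syntax: fix a countably infinite set $\mathbb P$ of propositional variables. $\mathcal L_{\Diamond\forall}$ is given by $\varphi ::= \bot \mid p \mid \varphi\wedge\varphi \mid \varphi\vee\varphi \mid \varphi\to\varphi \mid \circ\varphi \mid \Diamond\varphi \mid \forall\varphi$ with $p\in\mathbb P$; $\neg\varphi:=\varphi\to\bot$, $\varphi\leftrightarrow\psi:=(\varphi\to\psi)\wedge(\psi\to\varphi)$. Semantics: a dynamical system is $(X,\mathcal T,f)$ with $(X,\mathcal T)$ a topological space and $f\colon X\to X$ continuous. A valuation assigns to each formula an open set with $[\![\bot]\!]=\varnothing$, $[\![\varphi\wedge\psi]\!]=[\![\varphi]\!]\cap[\![\psi]\!]$, $[\![\varphi\vee\psi]\!]=[\![\varphi]\!]\cup[\![\psi]\!]$, $[\![\varphi\to\psi]\!]=\big((X\setminus[\![\varphi]\!])\cup[\![\psi]\!]\big)^\circ$, $[\![\circ\varphi]\!]=f^{-1}[\![\varphi]\!]$, $[\![\Diamond\varphi]\!]=\bigcup_{n<\omega}f^{-n}[\![\varphi]\!]$, $[\![\forall\varphi]\!]=X$ if $[\![\varphi]\!]=X$ and $\varnothing$ otherwise. Validity on a class: $[\![\varphi]\!]=X$ for every system in the class and every valuation. Logic: ${\sf ITL}^0_{\Diamond\forall}$ is the least set of $\mathcal L_{\Diamond\forall}$-formulas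 containing all substitution instances of the axioms of intuitionistic propositional logic and of (N1) $\neg\circ\bot$, (N2) $\circ\varphi\wedge\circ\psi\to\circ(\varphi\wedge\psi)$, (N3) $\circ(\varphi\vee\psi)\to\circ\varphi\vee\circ\psi$, (N4) $\circ(\varphi\to\psi)\to(\circ\varphi\to\circ\psi)$, (E1) $\varphi\vee\circ\Diamond\varphi\to\Diamond\varphi$, (UA1) $\forall\varphi\vee\neg\forall\varphi$, (UA2) $\forall(\varphi\to\psi)\to(\forall\varphi\to\forall\psi)$, (UA3) $\forall(\varphi\vee\forall\psi)\to\forall\varphi\vee\forall\psi$, (UA4) $\forall\varphi\to\varphi$, (UA5) $\forall\varphi\to\forall\forall\varphi$, (UA6) $\forall\varphi\leftrightarrow\circ\forall\varphi$, and closed under the rules: modus ponens; from $\varphi$ infer $\circ\varphi$; from $\varphi\to\psi$ infer $\Diamond\varphi\to\Diamond\psi$; from $\circ\varphi\to\varphi$ infer $\Diamond\varphi\to\varphi$; from $\varphi$ infer $\forall\varphi$. *)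

(* Defs.v *)
From HB Require Import structures.
From mathcomp Require Import all_boot all_order.
From mathcomp Require Import all_classical topology.

Set Implicit Arguments.
Unset Strict Implicit.
Unset Printing Implicit Defensive.

Local Open Scope classical_set_scope.

Inductive form : Type :=
  | Bot : form
  | Var : nat -> form
  | And : form -> form -> form
  | Or : form -> form -> form
  | Imp : form -> form -> form
  | Next : form -> form
  | Dia : form -> form
  | Univ : form -> form.

Definition Neg (a : form) : form := Imp a Bot.
Definition Iff (a b : form) : form := And (Imp a b) (Imp b a).

Inductive ITL0 : form -> Prop :=
  | IK   a b   : ITL0 (Imp a (Imp b a))
  | IS   a b c : ITL0 (Imp (Imp a (Imp b c)) (Imp (Imp a b) (Imp a c)))
  | IAnd1 a b  : ITL0 (Imp (And a b) a)
  | IAnd2 a b  : ITL0 (Imp (And a b) b)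
  | IAndI a b  : ITL0 (Imp a (Imp b (And a b)))
  | IOr1 a b   : ITL0 (Imp a (Or a b))
  | IOr2 a b   : ITL0 (Imp b (Or a b))
  | IOrE a b c : ITL0 (Imp (Imp a c) (Imp (Imp b c) (Imp (Or a b) c)))
  | IExf a     : ITL0 (Imp Bot a)
  | N1 : ITL0 (Neg (Next Bot))
  | N2 a b : ITL0 (Imp (And (Next a) (Next b)) (Next (And a b)))
  | N3 a b : ITL0 (Imp (Next (Or a b)) (Or (Next a) (Next b)))
  | N4 a b : ITL0 (Imp (Next (Imp a b)) (Imp (Next a) (Next b)))
  | E1 a : ITL0 (Imp (Or a (Next (Dia a))) (Dia a))
  | UA1 a : ITL0 (Or (Univ a) (Neg (Univ a)))
  | UA2 a b : ITL0 (Imp (Univ (Imp a b)) (Imp (Univ a) (Univ b)))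
  | UA3 a b : ITL0 (Imp (Univ (Or a (Univ b))) (Or (Univ a) (Univ b)))
  | UA4 a : ITL0 (Imp (Univ a) a)
  | UA5 a : ITL0 (Imp (Univ a) (Univ (Univ a)))
  | UA6 a : ITL0 (Iff (Univ a) (Next (Univ a)))
  | MP a b : ITL0 (Imp a b) -> ITL0 a -> ITL0 b
  | NecNext a : ITL0 a -> ITL0 (Next a)
  | MonDia a b : ITL0 (Imp a b) -> ITL0 (Imp (Dia a) (Dia b))
  | IndDia a : ITL0 (Imp (Next a) a) -> ITL0 (Imp (Dia a) a)
  | NecUniv a : ITL0 a -> ITL0 (Univ a).

Fixpoint den (X : topologicalType) (f : X -> X) (V : nat -> set X)
    (a : form) : set X :=
  match a with
  | Bot => set0
  | Var p => V p
  | And b c => den f V b `&` den f V c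
  | Or b c => den f V b `|` den f V c
  | Imp b c => interior ((~` den f V b) `|` den f V c)
  | Next b => f @^-1` den f V b
  | Dia b => \bigcup_(n in [set: nat]) ((iter n f) @^-1` den f V b)
  | Univ b => [set _ | den f V b = setT]
  end.

Definition valid_dyn (a : form) : Prop :=
  forall (X : topologicalType) (f : X -> X), continuous f ->
  forall V : nat -> set X, (forall p, open (V p)) ->
  den f V a = setT.

(* Main.v *)
(* Over a logic [L] that decides every [Univ] formula, the canonical model of
   prime theories (worlds), with inclusion and the map
   [next G = {a | Next a \in G}], has all the required properties except that
   [Dia a \in G] need not be witnessed by any iterate of [next].  Fix a finite
   set [S] of formulas; a world [H] simulates [G] when some relation linking
   them preserves membership in [S] and is forward confluent with inclusion.
   Replacing [next] by the nondeterministic relation "simulation, then next"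
   repairs the defect: up to equivalence only finitely many simulation types
   exist, and each is characterized by a formula that fails at [H] exactly when
   some world above [H] simulates it.  If no world reachable from [G] contained
   [a], the conjunction [c] of the formulas of the reachable worlds would
   satisfy [a -> c] and [Next c -> c], hence [Dia a -> c], yet [c] fails at [G].
   The infinite paths witnessing all eventualities, with the topology generated
   by pointwise inclusion on finite initial segments and the shift map, then
   form a dynamical system in which truth of a formula in [S] is membership in
   the first world.  Finally, for a prime theory [G] over [ITL0], the set
   [{a | Univ a \in G}] is a logic deciding every [Univ] formula. *)

Require Import Defs.
From HB Require Import structures.
From mathcomp Require Import all_boot all_classical topology.

Set Implicit Arguments.
Unset Strict Implicit.
Unset Printing Implicit Defensive.

Local Open Scope classical_set_scope.

(** * Logics, prime theories and derivability from hypotheses *)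

HB.instance Definition _ := gen_eqMixin form.

(** Kept abstract because [L] is later both [ITL0] and [univ_theory G]. *)
Record logic (L : set form) : Prop := Logic {
  logic_ITL0 : ITL0 `<=` L;
  logic_MP a b : L (Imp a b) -> L a -> L b;
  logic_NecNext a : L a -> L (Next a);
  logic_MonDia a b : L (Imp a b) -> L (Imp (Dia a) (Dia b));
  logic_IndDia a : L (Imp (Next a) a) -> L (Imp (Dia a) a) }.

Lemma ITL0_logic : logic ITL0.
Proof. by split=> //; [exact: MP | exact: NecNext | exact: MonDia | exact: IndDia]. Qed.

Record world (L : set form) := World {
  world_th :> form -> Prop;
  world_logic a : L a -> world_th a;
  world_MP a b : world_th (Imp a b) -> world_th a -> world_th b;
  world_Bot : ~ world_th Bot;
  world_prime a b : world_th (Or a b) -> world_th a \/ world_th b }.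

Definition wle L (G H : world L) := forall a, G a -> H a.

Lemma wle_refl L (G : world L) : wle G G. Proof. by []. Qed.

Lemma wle_trans L (G H K : world L) : wle G H -> wle H K -> wle G K.
Proof. by move=> GH HK a /GH /HK. Qed.

(** Hypotheses are combined by modus ponens alone; the modal rules act only inside [L]. This makes
    the deduction theorem hold. *)
Inductive entails (L A : set form) : form -> Prop :=
  | entails_ax a : L a -> entails L A a
  | entails_hyp a : A a -> entails L A a
  | entails_MP a b : entails L A (Imp a b) -> entails L A a -> entails L A b.

Lemma entails_mono L A B : A `<=` B -> entails L A `<=` entails L B.
Proof.
move=> AB a; elim=> {a} [a La|a /AB Ba|a b _ iab _ ia].
- exact: entails_ax.
- exact: entails_hyp.
- exact: entails_MP iab ia.
Qed.

(** * The canonical model of prime theories *)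

Section Lindenbaum.
Context (L : set form) (logicL : logic L).

Let thm a : ITL0 a -> L a. Proof. exact: logic_ITL0. Qed.

Let entails_thm A a : ITL0 a -> entails L A a.
Proof. by move=> /thm; exact: entails_ax. Qed.

Lemma deduction A a b : entails L (a |` A) b -> entails L A (Imp a b).
Proof.
elim=> {b} [b Lb|b [->|Ab]|b c _ ibc _ ib].
- by apply: entails_MP (entails_ax _ Lb); apply: entails_thm; exact: IK.
- apply: entails_MP (entails_thm _ (IK a a)).
  by apply: entails_MP (entails_thm _ (IK a (Imp a a))); apply: entails_thm; exact: IS.
- by apply: entails_MP (entails_hyp _ Ab); apply: entails_thm; exact: IK.
- by apply: entails_MP ib; apply: entails_MP ibc; apply: entails_thm; exact: IS.
Qed.

(** A derivation uses finitely many hypotheses, so those taken from a chain lie in a single member;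
    this serves Zorn's lemma. *)
Lemma entails_bigcup A (F : set (set form)) b : total_on F subset ->
  entails L (A `|` \bigcup_(B in F) B) b ->
  entails L A b \/ exists2 B, F B & entails L (A `|` B) b.
Proof.
move=> totF; elim=> {b} [b Lb|b [Ab|[B FB Bb]]|b c _ ibc _ ib].
- by left; exact: entails_ax.
- by left; exact: entails_hyp.
- by right; exists B => //; apply: entails_hyp; right.
- case: ibc ib => [ibc|[B FB ibc]] [ib|[C FC ic]].
  + by left; exact: entails_MP ibc ib.
  + right; exists C => //; apply: entails_MP ic.
    by apply: entails_mono ibc; exact: subsetUl.
  + right; exists B => //; apply: entails_MP ibc _.
    by apply: entails_mono ib; exact: subsetUl.
  + have [BC|CB] := totF _ _ FB FC.
      right; exists C => //; apply: entails_MP ic.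
      by apply: entails_mono ibc; exact: setUS.
    right; exists B => //; apply: entails_MP ibc _.
    by apply: entails_mono ic; exact: setUS.
Qed.

Lemma lindenbaum A b : ~ entails L A b ->
  exists G : world L, A `<=` G /\ ~ G b.
Proof.
move=> Ab; pose P := [set B | ~ entails L (A `|` B) b].
have [F FP totF|M [PM maxM]] := @Zorn_bigcup _ P.
  by move=> /(entails_bigcup totF)[//|[B /FP]].
pose T := entails L (A `|` M).
(* By maximality of [M], adding such an [a] makes [b] derivable; primeness of [T] follows from
   this. *)
have TN a : ~ T a -> T (Imp a b).
  move=> Ta; apply: deduction; apply: contrapT => nb.
  apply: (maxM (a |` M)); last by rewrite /P /= setUCA.
  split; first by right.
  by move=> /(_ a (or_introl erefl)) Ma; apply: Ta; apply: entails_hyp; right.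
have TBot : ~ T Bot.
  by move=> /(entails_MP (entails_thm _ (IExf b))).
have TOr a c : T (Or a c) -> T a \/ T c.
  move=> Tac; apply: contrapT => /not_orP[/TN Ta /TN Tc]; apply: PM.
  apply: entails_MP Tac; apply: entails_MP Tc; apply: entails_MP Ta.
  by apply: entails_thm; exact: IOrE.
exists (World (@entails_ax _ _) (@entails_MP _ _) TBot TOr); split => //.
by move=> a Aa; apply: entails_hyp; left.
Qed.

Implicit Types (G H : world L) (a b c : form).

Lemma world_ITL0 G a : ITL0 a -> G a.
Proof. by move=> /thm; exact: world_logic. Qed.

Lemma entails_world G : entails L G `<=` G.
Proof.
move=> a; elim=> {a} [a|//|a b _ Gab _]; first exact: world_logic.
exact: world_MP Gab.
Qed.

Lemma logic_world a : L a <-> forall G, G a.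
Proof.
split=> [La G|Ga]; first exact: world_logic.
apply: contrapT => La; have : ~ entails L set0 a.
  move=> D; apply: La; elim: D => {a Ga} // a b _ Lab _.
  exact: (logic_MP logicL Lab).
by move=> /lindenbaum[G [_]]; exact.
Qed.

Lemma world_Imp G a b : G (Imp a b) <-> forall H, wle G H -> H a -> H b.
Proof.
split=> [Gab H GH|Gab]; first exact: world_MP (GH _ Gab).
apply: contrapT => nGab.
have /lindenbaum[H [GaH]] : ~ entails L (a |` (G : set form)) b.
  by move=> /deduction/entails_world.
by apply; apply: Gab => [c Gc|]; apply: GaH; [right | left].
Qed.

Lemma logic_Imp a b : L (Imp a b) <-> forall G, G a -> G b.
Proof.
split=> [Lab G|Gab]; first by apply: world_MP; exact: world_logic.
by apply/logic_world => G; apply/world_Imp => H _; exact: Gab.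
Qed.

Lemma world_And G a b : G (And a b) <-> G a /\ G b.
Proof.
split=> [Gab|[Ga Gb]].
  by split; apply: world_MP Gab; apply: world_ITL0; [exact: IAnd1 | exact: IAnd2].
by apply: world_MP Gb; apply: world_MP Ga; apply: world_ITL0; exact: IAndI.
Qed.

Lemma world_Or G a b : G (Or a b) <-> G a \/ G b.
Proof.
split=> [|[]]; first exact: world_prime.
  by apply: world_MP; apply: world_ITL0; exact: IOr1.
by apply: world_MP; apply: world_ITL0; exact: IOr2.
Qed.

Lemma world_Neg G a : G (Neg a) -> ~ G a.
Proof. by move=> Gna Ga; apply: (@world_Bot _ G); exact: world_MP Gna Ga. Qed.

Fact next_logic G a : L a -> G (Next a).
Proof. by move=> /(logic_NecNext logicL); exact: world_logic. Qed.

Fact next_MP G a b : G (Next (Imp a b)) -> G (Next a) -> G (Next b).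
Proof. by move=> Gab; apply: world_MP; apply: world_MP Gab; apply: world_ITL0; exact: N4. Qed.

Fact next_Bot G : ~ G (Next Bot).
Proof. by apply: world_Neg; apply: world_ITL0; exact: N1. Qed.

Fact next_prime G a b : G (Next (Or a b)) -> G (Next a) \/ G (Next b).
Proof. by move=> Gab; apply: world_prime; apply: world_MP Gab; apply: world_ITL0; exact: N3. Qed.

Definition next G : world L :=
  World (@next_logic G) (@next_MP G) (@next_Bot G) (@next_prime G).

Lemma next_mono G H : wle G H -> wle (next G) (next H).
Proof. by move=> GH a; exact: GH. Qed.

(** The two diamond rules read on worlds: an induction principle for [Dia a] with the formula [b] as
    invariant. *)
Lemma logic_Dia a b :
    (forall G, G a -> G b) -> (forall G, next G b -> G b) ->
  forall G, G (Dia a) -> G b.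
Proof.
move=> ab nb G; apply: world_MP; apply: world_logic.
have /logic_Imp dadb := logic_MonDia logicL (proj2 (logic_Imp a b) ab).
have /logic_Imp dbb := logic_IndDia logicL (proj2 (logic_Imp (Next b) b) nb).
by apply/logic_Imp => H /dadb /dbb.
Qed.

(** From left to right this is induction with invariant [Or a (Next (Dia a))]. *)
Lemma world_Dia G a : G (Dia a) <-> G a \/ next G (Dia a).
Proof.
have fold H : H a \/ next H (Dia a) -> H (Dia a).
  by move=> /world_Or; apply: world_MP; apply: world_ITL0; exact: E1.
split; last exact: fold.
suff aux H : H (Dia a) -> H (Or a (Next (Dia a))).
  by move=> /aux/world_Or.
apply: logic_Dia => {}H; first by move=> Ha; apply/world_Or; left.
by move=> /world_Or ?; apply/world_Or; right; exact: (fold (next H)).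
Qed.

Definition bigAnd := foldr And (Imp Bot Bot).
Definition bigOr := foldr Or Bot.

Lemma world_bigAnd G s : G (bigAnd s) <-> {in s, forall a, G a}.
Proof.
elim: s => [|a s IHs] /=.
  by split=> // _; apply/world_Imp.
split=> [/world_And[Ga /IHs Gs] b|Gs].
  by rewrite inE => /predU1P[->|/Gs].
apply/world_And; split; first by apply: Gs; rewrite mem_head.
by apply/IHs => b bs; apply: Gs; rewrite inE bs orbT.
Qed.

Lemma world_bigOr G s : G (bigOr s) <-> exists2 a, a \in s & G a.
Proof.
elim: s => [|a s IHs] /=.
  by split=> [/world_Bot|[]].
split=> [/world_Or[Ga|/IHs[b bs Gb]]|[b]].
- by exists a => //; rewrite mem_head.
- by exists b => //; rewrite inE bs orbT.
- rewrite inE => /predU1P[->|bs] Gb; apply/world_Or; first by left.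
  by right; apply/IHs; exists b.
Qed.

End Lindenbaum.

(** * Simulations and their characteristic formulas *)

Fixpoint sublists (T : Type) (s : seq T) : seq (seq T) :=
  if s is x :: s' then [seq x :: t | t <- sublists s'] ++ sublists s' else [:: [::]].

Lemma filter_sublists (T : eqType) (p : pred T) s : [seq x <- s | p x] \in sublists s.
Proof.
elim: s => //= x s IHs; rewrite mem_cat; case: (p x); last by rewrite IHs orbT.
by rewrite map_f.
Qed.

Lemma sub_count_lt (T : eqType) (p q : pred T) s x :
  subpred p q -> x \in s -> q x -> ~~ p x -> count p s < count q s.
Proof.
move=> pq xs qx npx; have [s1 s2] := path.splitPr xs.
rewrite !count_cat /= qx (negbTE npx) -addnS leq_add ?sub_count //.
by rewrite add0n ltnS sub_count.
Qed.

Section Simulation.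
Context (L : set form) (logicL : logic L) (S : seq form).
Implicit Types (G H D : world L) (a b c : form).

Definition agree G H := {in S, forall a, G a <-> H a}.

Definition sim G H := exists E : world L -> world L -> Prop,
  E G H /\ forall x y, E x y ->
    agree x y /\ forall x', wle x x' -> exists2 y', wle y y' & E x' y'.

Lemma sim_agree G H : sim G H -> agree G H.
Proof. by move=> [E [EGH /(_ _ _ EGH)[]]]. Qed.

Lemma sim_forth G H G' : sim G H -> wle G G' -> exists2 H', wle H H' & sim G' H'.
Proof.
move=> [E [EGH simE]] /(proj2 (simE _ _ EGH))[H' HH' EGH'].
by exists H' => //; exists E.
Qed.

Lemma sim_refl G : sim G G.
Proof.
exists eq; split=> // x y <-; split=> // x' xx'.
by exists x'.
Qed.

(* Worlds above [G] agreeing with [G] may all be matched with [H] itself. *)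
Lemma sim_intro G H : agree G H ->
  (forall G', wle G G' -> ~ agree G G' -> exists2 H', wle H H' & sim G' H') ->
  sim G H.
Proof.
move=> GH up; exists (fun x y => sim x y \/ [/\ wle G x, agree G x & y = H]).
split; first by right; split.
move=> x y [xy|[Gx agGx ->]].
  split=> [|x' /(sim_forth xy)[y' yy' x'y']]; first exact: sim_agree.
  by exists y' => //; left.
split=> [a aS|x' xx']; first by rewrite -(agGx _ aS); exact: GH.
have Gx' := wle_trans Gx xx'.
have [agGx'|/(up _ Gx')[y' Hy' x'y']] := pselect (agree G x').
  by exists H => //; right.
by exists y' => //; left.
Qed.

(** An analogue of a Jankov formula, put negatively because failure of a formula, like having a
    simulating world above, is inherited downwards along [wle]. *)
Definition characterizes a G :=
  forall H, ~ H a <-> exists2 H', wle H H' & sim G H'.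

(** Induction measure: it drops on moving up to a world that disagrees on [S]. *)
Definition deficit G := count (fun a => ~~ `[< G a >]) S.

Lemma deficit_lt G H : wle G H -> ~ agree G H -> deficit H < deficit G.
Proof.
move=> GH /existsNP[a /not_implyP[aS GHa]].
have [nGa Ha] : ~ G a /\ H a.
  split=> [Ga|]; first by apply: GHa; split=> // _; exact: GH.
  by apply: contrapT => nHa; apply: GHa; split=> // /GH.
apply: (@sub_count_lt _ _ _ _ a) => //=; last by rewrite negbK; exact/asboolP.
  by move=> b; apply: contra => /asboolP/GH ?; exact/asboolP.
exact/asboolPn.
Qed.

(** Induction on the deficit. The formula of [G] says that the members of [S] true at [G] imply one
    of those false at [G] or a formula characterizing some disagreeing world above [G]. All parts
    come from finite lists, so one [F] serves all worlds. *)
Lemma characteristic_formulas : exists F : seq form,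
  forall G, exists2 a, a \in F & characterizes a G.
Proof.
suff [F FP] : exists F : seq form, forall G, deficit G < (size S).+1 ->
    exists2 a, a \in F & characterizes a G.
  by exists F => G; apply: FP; rewrite ltnS count_size.
elim: (size S).+1 => [|n [F FP]]; first by exists [::].
exists [seq Imp (bigAnd A) (bigOr B) | A <- sublists S, B <- sublists (S ++ F)].
move=> G dG.
pose above b := exists G', [/\ wle G G', ~ agree G G' & characterizes b G'].
pose A := [seq a <- S | `[< G a >]].
pose B := [seq b <- S ++ F | `[< b \in S /\ ~ G b \/ above b >]].
exists (Imp (bigAnd A) (bigOr B)).
  by apply: (allpairs_f (fun A B => Imp (bigAnd A) (bigOr B))); exact: filter_sublists.
have BP b : b \in B <-> (b \in S /\ ~ G b) \/ (b \in S ++ F /\ above b).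
  rewrite mem_filter; split=> [/andP[/asboolP[|]]|[[bS nGb]|[bSF abb]]].
  - by left.
  - by right.
  - by rewrite mem_cat bS andbT; apply/asboolP; left.
  - by rewrite bSF andbT; apply/asboolP; right.
move=> H; split=> [|[H' HH' GH'] /(world_Imp logicL)/(_ _ HH')].
  move=> /(world_Imp logicL)/existsNP[H' /not_implyP[HH' /not_implyP[]]].
  move=> /(world_bigAnd logicL) H'A /(world_bigOr logicL) H'B; exists H' => //.
  apply: sim_intro => [a aS|G' GG' nGG'].
    split=> [Ga|H'a]; first by apply: H'A; rewrite mem_filter aS andbT; exact/asboolP.
    by apply: contrapT => nGa; apply: H'B; exists a => //; apply/BP; left.
  have [b bF bG'] := FP G' (leq_trans (deficit_lt GG' nGG') dG).
  apply/bG' => H'b; apply: H'B; exists b => //; apply/BP; right.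
  by rewrite mem_cat bF orbT; split=> //; exists G'.
have H'A : H' (bigAnd A).
  apply/(world_bigAnd logicL) => a; rewrite mem_filter => /andP[/asboolP Ga aS].
  exact/(sim_agree GH' aS).
move=> /(_ H'A)/(world_bigOr logicL)[b /BP[[bS nGb] /(sim_agree GH' bS)//|]].
move=> [_ [G' [GG' _ bG']]] H'b.
have [H'' H'H'' simG'] := sim_forth GH' GG'.
by apply: (proj2 (bG' H')) H'b; exists H''.
Qed.

(** * The nondeterministic successor relation and witnesses for eventualities *)

Definition step G D := exists2 G', sim G G' & D = next logicL G'.

Lemma step_next G : step G (next logicL G).
Proof. by exists G => //; exact: sim_refl. Qed.

Lemma step_forth G D G' : step G D -> wle G G' -> exists2 D', wle D D' & step G' D'.
Proof.
move=> [H GH ->] /(sim_forth GH)[H' HH' G'H'].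
by exists (next logicL H'); [exact: next_mono | exists H'].
Qed.

Lemma step_Next G D a : step G D -> Next a \in S -> G (Next a) <-> D a.
Proof. by move=> [H GH ->] aS; exact: (sim_agree GH aS). Qed.

Lemma step_Dia G D a : step G D -> a \in S -> Dia a \in S ->
  G (Dia a) <-> G a \/ D (Dia a).
Proof.
move=> [H GH ->] aS daS.
by rewrite (sim_agree GH daS) (sim_agree GH aS); exact: world_Dia.
Qed.

Fixpoint steps G s := if s is D :: s' then step G D /\ steps D s' else True.

Lemma steps_cat G s t : steps G (s ++ t) <-> steps G s /\ steps (last G s) t.
Proof.
elim: s G => [|D s IHs] G /=; first by split=> [|[]].
by rewrite IHs; split=> [[? []]|[[]]].
Qed.

Lemma Dia_witness G a : a \in S -> G (Dia a) ->
  exists2 s, steps G s & last G s a.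
Proof.
move=> aS Gda; apply: contrapT => nwit.
pose reach D := exists2 s, steps G s & last G s = D.
have nreach D : reach D -> ~ D a.
  by move=> [s Gs <-] Da; apply: nwit; exists s.
have [F FP] := characteristic_formulas.
(* A finite conjunction even if infinitely many worlds are reachable, since its members come from
   [F]. *)
pose c := bigAnd [seq b <- F | `[< exists2 D, reach D & characterizes b D >]].
have nc H : ~ H c <-> exists2 D, reach D & exists2 H', wle H H' & sim D H'.
  split=> [|[D rD DH] Hc].
    move=> /(world_bigAnd logicL)/existsNP[b /not_implyP[]].
    rewrite mem_filter => /andP[/asboolP[D rD bD] _] /bD DH.
    by exists D.
  have [b bF bD] := FP D.
  apply: (proj2 (bD H) DH); apply: (proj1 (world_bigAnd logicL _ _) Hc).
  by rewrite mem_filter bF andbT; apply/asboolP; exists D.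
have: G c.
  apply: (@logic_Dia _ logicL a c) Gda => H.
    move=> Ha; apply: contrapT => /nc[D rD [H' HH' DH']].
    by apply: (nreach D rD); apply/(sim_agree DH' aS); exact: HH'.
  (* If [c] fails at [H], some [H'] above [H] simulates a reachable [D]. One step from [D] leads to
     the [next] of [H'], so [c] fails there and also below it, at the [next] of [H]. *)
  move=> nHc; apply: contrapT => /nc[D [s Gs sD] [H' HH' DH']].
  move: nHc; apply/nc; exists (next logicL H').
    exists (rcons s (next logicL H')); last by rewrite last_rcons.
    by rewrite -cats1; apply/steps_cat; split=> //=; split=> //; rewrite sD; exists H'.
  by exists (next logicL H'); [exact: next_mono | exact: sim_refl].
apply/nc; exists G; first by exists [::].
by exists G => //; exact: sim_refl.
Qed.

End Simulation.

(** * Infinite paths that fulfil every eventuality *)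

Section Realization.
Context (L : set form) (logicL : logic L) (S : seq form).
Implicit Types (G H D : world L) (a b c : form).

Local Notation step := (step logicL S).
Local Notation steps := (steps logicL S).

Lemma steps_Dia G s a : steps G s -> a \in S -> Dia a \in S -> G (Dia a) ->
  (exists2 i, i <= size s & nth G (G :: s) i a) \/ last G s (Dia a).
Proof.
move=> + aS daS; elim: s G => [|D s IHs] G /= => [_|[GD Ds]]; first by right.
move=> /(step_Dia GD aS daS)[Ga|/(IHs _ Ds)[[i ilt ia]|]]; last by right.
  by left; exists 0.
by left; exists i.+1; rewrite //= (set_nth_default D).
Qed.

Definition fulfils G s := forall a, a \in S -> Dia a \in S -> G (Dia a) ->
  exists2 i, i <= size s & nth G (G :: s) i a.

(** Eventualities are treated one by one: a witness keeps its index when the path is prolonged, and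
    an eventuality still pending at the end gets one from [Dia_witness]. Nonemptiness lets a path
    pieced together from such plans always advance. *)
Lemma fulfilling_steps G : exists s, [/\ 0 < size s, steps G s & fulfils G s].
Proof.
suff /(_ S)[s [s0 Gs sP]] : forall ds : seq form, exists s, [/\ 0 < size s, steps G s &
    forall a, a \in ds -> a \in S -> Dia a \in S -> G (Dia a) ->
    exists2 i, i <= size s & nth G (G :: s) i a].
  by exists s; split=> // a aS; exact: sP.
elim=> [|d ds [s [s0 Gs sP]]].
  by exists [:: next logicL G]; split=> //; split=> //; exact: step_next.
suff [t [Gst tP]] : exists t, steps G (s ++ t) /\
    (d \in S -> Dia d \in S -> G (Dia d) ->
     exists2 i, i <= size (s ++ t) & nth G (G :: s ++ t) i d).
  exists (s ++ t); split=> //; first by rewrite size_cat ltn_addr.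
  move=> a; rewrite inE => /predU1P[->|/sP{}sP] //.
  move=> aS daS /(sP aS daS)[i ile ia]; exists i.
    by rewrite size_cat (leq_trans ile) // leq_addr.
  by rewrite -cat_cons nth_cat /= ltnS ile.
have [[dS ddS Gd]|nd] := pselect [/\ d \in S, Dia d \in S & G (Dia d)]; last first.
  by exists [::]; rewrite cats0; split=> // dS ddS Gd; case: nd.
have [wit|/(Dia_witness logicL dS)[t st td]] := steps_Dia Gs dS ddS Gd.
  by exists [::]; rewrite cats0; split.
exists t; split=> [|_ _ _]; first exact/steps_cat.
exists (size (s ++ t)) => //.
by rewrite -[size _]/(size (G :: s ++ t)).-1 nth_last /= last_cat.
Qed.

Record rpath := RPath {
  rpath_fun :> nat -> world L;
  rpath_step n : step (rpath_fun n) (rpath_fun n.+1);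
  rpath_Dia n a : a \in S -> Dia a \in S -> rpath_fun n (Dia a) ->
    exists2 m, n <= m & rpath_fun m a }.

Implicit Types p q : rpath.

(* A path is run along with the rest of its current plan; a new plan
   fulfilling all pending eventualities is made when the old one runs out. *)
Lemma rpath_from G : exists p, p 0 = G.
Proof.
have [plan planP] := choice fulfilling_steps.
pose nxt (x : world L * seq (world L)) : world L * seq (world L) :=
  match x.2, plan x.1 with
  | D :: s, _ => (D, s)
  | [::], D :: s => (D, s)
  | [::], [::] => x
  end.
pose st n := iter n nxt (G, [::]).
have nxtP x : steps x.1 x.2 -> step x.1 (nxt x).1 /\ steps (nxt x).1 (nxt x).2.
  case: x => D [|D' s] //= _; rewrite /nxt /=.
  by have [] := planP D; case: (plan D).
have stP n : steps (st n).1 (st n).2.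
  by elim: n => [//|n /nxtP[_]]; rewrite /st iterS.
have run x0 D s i : i <= size s -> iter i nxt (D, s) = (nth x0 (D :: s) i, drop i s).
  elim: i D s => [|i IHi] D [|D' s] //= ile.
  by rewrite -iterS iterSr [nxt _]/= IHi.
have run_plan D i : i <= size (plan D) ->
    (iter i nxt (D, [::])).1 = nth D (D :: plan D) i.
  case: i => [//|i]; rewrite iterSr /nxt /=; case: (plan D) => [//|D' s] /= ile.
  by rewrite -/nxt (run D).
have Dia_st n a : a \in S -> Dia a \in S -> (st n).1 (Dia a) ->
    exists2 m, n <= m & (st m).1 a.
  move=> aS daS; have := stP n; case En: (st n) => [D s] /= Ds Da.
  have stD i : st (i + n) = iter i nxt (D, s) by rewrite /st iterD -/(st n) En.
  have [[i ile ia]|] := steps_Dia Ds aS daS Da.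
    by exists (i + n); rewrite ?leq_addl // stD (run D).
  have := stD (size s); rewrite (run D) // drop_size -[size s]/(size (D :: s)).-1.
  rewrite nth_last /=; set D' := last D s => stD' D'a.
  have [_ _ /(_ a aS daS D'a)[i ile ia]] := planP D'.
  exists (i + (size s + n)); first by rewrite addnA leq_addl.
  by rewrite /st iterD -/(st (size s + n)) stD' run_plan.
have step_st n : step (st n).1 (st n.+1).1 by have [] := nxtP _ (stP n).
by exists (RPath step_st Dia_st).
Qed.

Fact shift_Dia p n a : a \in S -> Dia a \in S -> p n.+1 (Dia a) ->
  exists2 m, n <= m & p m.+1 a.
Proof. by move=> aS daS /(rpath_Dia aS daS)[[|m] // nm ma]; exists m. Qed.

Definition shift p : rpath := RPath (fun n => rpath_step p n.+1) (@shift_Dia p).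

Fact extend_step G p : step G (p 0) ->
  forall n, step (if n is m.+1 then p m else G) (p n).
Proof. by move=> Gp [|n] //=; exact: rpath_step. Qed.

Fact extend_Dia G p : step G (p 0) ->
  forall n a, a \in S -> Dia a \in S ->
    (if n is m.+1 then p m else G) (Dia a) ->
  exists2 m, n <= m & (if m is k.+1 then p k else G) a.
Proof.
move=> Gp n a aS daS; have pP k : p k (Dia a) ->
    exists2 m, k < m & (if m is k.+1 then p k else G) a.
  by move=> /(rpath_Dia aS daS)[m km ma]; exists m.+1.
case: n => [/(step_Dia Gp aS daS)[Ga|/pP[m _ ma]]|n /pP//]; first by exists 0.
by exists m.
Qed.

Definition extend G p (Gp : step G (p 0)) : rpath :=
  RPath (extend_step Gp) (extend_Dia Gp).

(** * The topology on paths and the truth lemma *)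

Definition above p n : set rpath := [set q | forall i, i <= n -> wle (p i) (q i)].

(** Forward confluence lifts the first [n] steps, then a fresh path takes over. Lifting every step
    would not guarantee that the lifted path meets its eventualities, which is why neighbourhoods
    constrain only finite segments. *)
Lemma rpath_above n p G : wle (p 0) G -> exists2 q, above p n q & q 0 = G.
Proof.
elim: n p G => [|n IHn] p G pG.
  have [q qG] := rpath_from G.
  by exists q => // -[|//] _; rewrite qG.
have [D pD GD] := step_forth (rpath_step p 0) pG.
have [q pq qD] := IHn (shift p) D pD.
have Gq : step G (q 0) by rewrite qD.
by exists (extend Gq) => // -[|i] //= /pq.
Qed.

Definition rpath_open (U : set rpath) := forall p, U p -> exists n, above p n `<=` U.

Fact rpath_openT : rpath_open setT. Proof. by move=> p _; exists 0. Qed.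

Fact rpath_openI : setI_closed rpath_open.
Proof.
move=> U V oU oV p [/oU[m mU] /oV[n nV]]; exists (maxn m n) => q pq.
by split; [apply: mU | apply: nV] => i ile; apply: pq; rewrite leq_max ile ?orbT.
Qed.

Fact rpath_open_bigU (I : Type) (f : I -> set rpath) :
  (forall i, rpath_open (f i)) -> rpath_open (\bigcup_i f i).
Proof.
by move=> of_ p [i _ /of_[n nf]]; exists n => q /nf fq; exists i.
Qed.

HB.instance Definition _ := gen_eqMixin rpath.
HB.instance Definition _ := gen_choiceMixin rpath.
HB.instance Definition _ :=
  isOpenTopological.Build rpath rpath_openT rpath_openI rpath_open_bigU.

Lemma openP (U : set rpath) : open U <-> rpath_open U.
Proof. by []. Qed.

Lemma interiorP (U : set rpath) p : interior U p <-> exists n, above p n `<=` U.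
Proof.
rewrite interiorEbigcup; split=> [[V [/openP oV VU] Vp]|[n pU]].
  by move: Vp => /oV[n pV]; exists n => q /pV/VU.
exists (above p n) => [|i _]; last exact: wle_refl.
split; last exact: pU.
apply/openP => q pq; exists n => r qr i ile.
exact: wle_trans (pq _ ile) (qr _ ile).
Qed.

Lemma shift_continuous : continuous shift.
Proof.
(* Indices [0] to [n] of the shifted path are [1] to [n.+1] of the original. *)
apply/continuousP => U /openP oU; apply/openP => p /oU[n nU]; exists n.+1 => q pq.
by apply: nU => i ile; exact: pq.
Qed.

Definition rpath_val (v : nat) : set rpath := [set p : rpath | p 0 (Var v)].

Lemma rpath_val_open v : open (rpath_val v).
Proof. by apply/openP => p pv; exists 0 => q pq; exact: (pq 0). Qed.

Fixpoint subforms a := a :: match a with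
  | And b c | Or b c | Imp b c => subforms b ++ subforms c
  | Next b | Dia b | Univ b => subforms b
  | Bot | Var _ => [::]
  end.

Lemma mem_subforms a : a \in subforms a.
Proof. by case: a => *; rewrite mem_head. Qed.

Lemma iter_shift n p m : iter n shift p m = p (m + n).
Proof. by elim: n m => [|n IHn] m; rewrite ?addn0 //= IHn addnS. Qed.

Lemma truth (necL : forall a, L a -> L (Univ a))
    (decL : forall a, L a \/ L (Neg (Univ a))) a :
  {subset subforms a <= S} -> forall p, den shift rpath_val a p <-> p 0 a.
Proof.
elim: a => [|v|b IHb c IHc|b IHb c IHc|b IHb c IHc|b IHb|b IHb|b IHb] sub p /=.
- by split=> // /world_Bot.
- by [].
- have {}IHb := IHb _ p; have {}IHc := IHc _ p.
  rewrite (world_And logicL) -IHb ?IHc // => d dbc; apply: sub;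
  by rewrite inE mem_cat dbc ?orbT.
- rewrite (world_Or logicL) -IHb ?IHc // => d dbc; apply: sub;
  by rewrite inE mem_cat dbc ?orbT.
- have {}IHb q : den shift rpath_val b q <-> q 0 b.
    by apply: IHb => d db; apply: sub; rewrite inE mem_cat db ?orbT.
  have {}IHc q : den shift rpath_val c q <-> q 0 c.
    by apply: IHc => d dc; apply: sub; rewrite inE mem_cat dc ?orbT.
  rewrite interiorP (world_Imp logicL); split=> [[n nbc] H pH Hb|pbc].
    (* However large [n] is, [H] starts a path inside [above p n], so the topological interior sees
       every world above [p 0]. *)
    have [q pq q0] := rpath_above n pH.
    have := nbc _ pq; rewrite -q0 => -[nb|/IHc//].
    by case: nb; apply/IHb; rewrite q0.
  exists 0 => q /(_ 0 isT) pq; rewrite /setU /setC /=.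
  have [qb|] := pselect (den shift rpath_val b q); last by left.
  by right; apply/IHc; apply: pbc pq _; exact/IHb.
- rewrite /preimage /= IHb => [|d db]; last by apply: sub; rewrite inE db orbT.
  by rewrite (step_Next (rpath_step p 0)) //; apply: sub; rewrite mem_head.
- have daS : Dia b \in S by apply: sub; rewrite mem_head.
  have subb : {subset subforms b <= S} by move=> d db; apply: sub; rewrite inE db orbT.
  have bS : b \in S by apply: subb; exact: mem_subforms.
  split=> [[n _ /(IHb subb)]|/(rpath_Dia bS daS)[n _ nb]].
    rewrite iter_shift add0n; elim: n p => [|n IHn] p pb.
      by apply/(step_Dia (rpath_step p 0) bS daS); left.
    apply/(step_Dia (rpath_step p 0) bS daS); right.
    exact: (IHn (shift p)).
  by exists n => //; apply/(IHb subb); rewrite iter_shift.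
- have {}IHb q : den shift rpath_val b q <-> q 0 b.
    by apply: IHb => d db; apply: sub; rewrite inE db orbT.
  (* Either [b] is in [L], or [L] refutes [Univ b]. In the latter case [b] cannot hold on all paths:
     every world starts a path, so [b] would be in all worlds, hence in [L]. *)
  case: (decL b) => [Lb|LnUb].
    split=> _; first exact: world_logic (necL _ Lb).
    by apply/seteqP; split=> // q _; apply/IHb; exact: world_logic.
  split=> [bT|/(world_Neg (world_logic _ LnUb))//].
  apply: world_logic; apply: necL.
  apply/(logic_world logicL) => G; have [q <-] := rpath_from G.
  by apply/IHb; rewrite bT.
Qed.

End Realization.

Lemma univ_completeness L (logicL : logic L)
    (necL : forall a, L a -> L (Univ a)) (decL : forall a, L a \/ L (Neg (Univ a))) a :
  valid_dyn a -> L a.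
Proof.
move=> valid_a; apply/(logic_world logicL) => G.
have [p <-] := rpath_from logicL (subforms a) G.
apply/(truth necL decL (fun _ => id)).
by rewrite valid_a //; [exact: shift_continuous | exact: rpath_val_open].
Qed.

(** * The logic of formulas universally true in a prime theory *)

Section UnivTheory.
Let logic0 := ITL0_logic.
Implicit Types (G : world ITL0) (a b : form).

Lemma Univ_Imp a b : ITL0 (Imp (Univ a) b) -> ITL0 (Imp (Univ a) (Univ b)).
Proof.
move=> /NecUniv/(MP (UA2 _ _))/(logic_Imp logic0) UUa.
by apply/(logic_Imp logic0) => G Ua; apply: UUa; apply: world_MP Ua; apply: world_logic; exact: UA5.
Qed.

Lemma Univ_Next G a : G (Univ a) <-> next logic0 G (Univ a).
Proof.
have [] := proj1 (world_And logic0 G _ _) (world_logic G (UA6 a)).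
by move=> UN NU; split; [exact: world_MP UN | exact: world_MP NU].
Qed.

Lemma Univ_elim G a : G (Univ a) -> G a.
Proof. by apply: world_MP; apply: world_logic; exact: UA4. Qed.

Lemma Univ_NecNext a : ITL0 (Imp (Univ a) (Next a)).
Proof. by apply/(logic_Imp logic0) => G /Univ_Next/Univ_elim. Qed.

(** Internalizes the induction rule: its premise becomes the antecedent of the invariant [c], and
    [UA6] carries that premise along [next]. The monotonicity rule is treated likewise below. *)
Lemma Univ_IndDia a : ITL0 (Imp (Univ (Imp (Next a) a)) (Imp (Dia a) a)).
Proof.
pose c := Imp (Univ (Imp (Next a) a)) a.
have ind G : G (Dia a) -> G c.
  apply: (@logic_Dia _ logic0 a c) => {}G.
    by move=> Ga; apply/(world_Imp logic0) => H /(_ _ Ga).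
  move=> Nc; apply/(world_Imp logic0) => H GH Ui.
  apply: world_MP (Univ_elim Ui) _; apply: world_MP (next_mono GH Nc) _.
  exact: (proj1 (Univ_Next _ _)) Ui.
apply/(logic_Imp logic0) => G Ui; apply/(world_Imp logic0) => H GH /ind Hc.
by apply: world_MP Hc _; exact: GH.
Qed.

Lemma Univ_MonDia a b : ITL0 (Imp (Univ (Imp a b)) (Imp (Dia a) (Dia b))).
Proof.
pose c := Imp (Univ (Imp a b)) (Dia b).
have ind G : G (Dia a) -> G c.
  apply: (@logic_Dia _ logic0 a c) => {}G.
    move=> Ga; apply/(world_Imp logic0) => H GH /Univ_elim Hab.
    by apply/(world_Dia logic0); left; apply: world_MP Hab _; exact: GH.
  move=> Nc; apply/(world_Imp logic0) => H GH Ui.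
  apply/(world_Dia logic0); right; apply: world_MP (next_mono GH Nc) _.
  exact: (proj1 (Univ_Next _ _)) Ui.
apply/(logic_Imp logic0) => G Ui; apply/(world_Imp logic0) => H GH /ind Hc.
by apply: world_MP Hc _; exact: GH.
Qed.

Definition univ_theory G : set form := [set a | G (Univ a)].

Lemma univ_theory_logic G : logic (univ_theory G).
Proof.
have UG a b : ITL0 (Imp (Univ a) b) -> G (Univ a) -> G (Univ b).
  by move=> /Univ_Imp Uab; apply: world_MP; exact: world_logic.
split=> [a a0|a b Uab|a|a b|a].
- by apply: world_logic; exact: NecUniv.
- by apply: world_MP; apply: world_MP Uab; apply: world_logic; exact: UA2.
- by apply: UG; exact: Univ_NecNext.
- by apply: UG; exact: Univ_MonDia.
- by apply: UG; exact: Univ_IndDia.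
Qed.

Lemma univ_theory_Univ G a : univ_theory G a -> univ_theory G (Univ a).
Proof. by apply: world_MP; apply: world_logic; exact: UA5. Qed.

(** Necessitate the excluded middle [UA1], distribute [Univ] over it by [UA3], and let primeness of
    [G] choose a side. *)
Lemma univ_theory_dec G a : univ_theory G a \/ univ_theory G (Neg (Univ a)).
Proof.
suff /world_prime[] : G (Or (Univ (Neg (Univ a))) (Univ a)) by [right | left].
apply: world_logic; apply: MP (UA3 _ _) (NecUniv _).
apply/(logic_world logic0) => H; apply/(world_Or logic0).
have /world_prime[] : H (Or (Univ a) (Neg (Univ a))) by apply: world_logic; exact: UA1.
  by right.
by left.
Qed.

End UnivTheory.

Theorem theorem9p8 : forall a : form, valid_dyn a -> ITL0 a.
Proof.
(* It suffices that each prime theory [G] contains [Univ a], that is, that [a] belongs to the logic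
   [univ_theory G]. *)
move=> a valid_a; apply/(logic_world ITL0_logic) => G; apply: Univ_elim.
exact: univ_completeness (univ_theory_logic G) (@univ_theory_Univ G)
  (@univ_theory_dec G) a valid_a.
Qed.
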